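(* Let $b,c>0$ and let $f,h\in L^4[-\tfrac{c}{2},\tfrac{c}{2}]$ be complex-valued. If $|\mathcal{G}f(x,\omega)|=|\mathcal{G}h(x,\omega)|$ for every $(x,\omega)\in \tfrac{1}{b}\mathbb{Z}\times\tfrac{1}{2c}\mathbb{Z}$, then there exists $\tau\in\mathbb{C}$ with $|\tau|=1$ such that $f=\tau h$.
   Context: Functions in $L^4[-\tfrac{c}{2},\tfrac{c}{2}]$ are regarded as functions on $\mathbb{R}$ vanishing outside $[-\tfrac{c}{2},\tfrac{c}{2}]$ (hence elements of $L^2(\mathbb{R})$), and equality of functions means equality almost everywhere. The Gabor transform of $f\in L^2(\mathbb{R})$ is $\mathcal{G}f(x,\omega)=\int_{\mathbb{R}} f(t)\varphi(t-x)e^{-2\pi i t\omega}\,dt$ for $(x,\omega)\in\mathbb{R}^2$, where $\varphi(t)=e^{-\pi t^2}$. *)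

(* Defs.v *)
From HB Require Import structures.
From mathcomp Require Import all_boot all_order all_algebra.
From mathcomp Require Import all_classical all_reals all_analysis.
From mathcomp Require Import complex.

Set Implicit Arguments.
Unset Strict Implicit.
Unset Printing Implicit Defensive.

Import Order.TTheory GRing.Theory Num.Theory.
Import numFieldNormedType.Exports.

Local Open Scope classical_set_scope.
Local Open Scope ring_scope.
Local Open Scope complex_scope.

Section Gabor.
Context {R : realType}.
Implicit Types (f : R -> R[i]) (c p : R).

Local Notation mu := (@lebesgue_measure R).
Local Notation modulus := ComplexField.Normc.normc.

Definition zero_ext c f : R -> R[i] :=
  patch (cst 0) `[- (c / 2), c / 2]%classic f.

(* [R[i]] carries no sigma-algebra in the library; measurability and integrals
   of complex functions are taken componentwise. *)
Definition complex_measurable f : Prop :=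
  measurable_fun [set: R] (fun t => complex.Re (f t)) /\
  measurable_fun [set: R] (fun t => complex.Im (f t)).

(* A predicate on representatives: equality in L^p is equality [mu]-a.e. *)
Definition complex_Lp p f : Prop :=
  complex_measurable f /\ finite_norm mu p%:E (fun t => modulus (f t)).

Definition Lp_interval p c f : Prop := complex_Lp p (zero_ext c f).

Definition complex_integral f : R[i] :=
  (\int[mu]_t complex.Re (f t)) +i* (\int[mu]_t complex.Im (f t)).

Definition gauss (t : R) : R := expR (- (pi * t ^+ 2)).

(* e^(i theta) *)
Definition cis (theta : R) : R[i] := cos theta +i* sin theta.

Definition gabor f (x omega : R) : R[i] :=
  complex_integral
    (fun t => f t * (gauss (t - x))%:C * cis (- (2 * pi * t * omega))).

End Gabor.

(* Main.v *)
(* For F = f gauss, |G f (x, w)|^2 equals, up to the factor exp (- 2 pi x^2), the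
   double integral of F(t) conj(F(u)) exp (2 pi x (t + u)) exp (- 2 pi i w (t - u)).
   Sampling x in Z/b and w in Z/(2c) therefore gives the integrals of
   F (x) conj F against all monomials in exp (2 pi (t + u) / b),
   cos (pi (t - u) / c) and sin (pi (t - u) / c).  These three functions separate
   the points of the open square ]-c/2, c/2[^2, so the moments determine F (x) conj F
   on every rectangle: in one variable, moments determine the integral over
   {g > a} because its indicator is a bounded pointwise limit of polynomials in g,
   and a pi-lambda argument does the rest.  Finally F(A) conj F(B) = H(A) conj H(B)
   for the set functions A |-> int_A F, A |-> int_A H forces F = tau H. *)
Require Import Defs.
From HB Require Import structures.
From mathcomp Require Import all_boot all_order all_algebra.
From mathcomp Require Import all_classical all_reals all_analysis.
From mathcomp Require Import complex.
From mathcomp Require Import measurable_realfun.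
From mathcomp Require Import ring lra.

Set Implicit Arguments.
Unset Strict Implicit.
Unset Printing Implicit Defensive.

Import Order.TTheory GRing.Theory Num.Theory.
Import numFieldNormedType.Exports.

Local Open Scope classical_set_scope.
Local Open Scope ring_scope.
Local Open Scope complex_scope.

(** * Moments determine integrals over preimages *)

Section Threshold.
Context {R : realType}.
Implicit Types (x r : R) (n k : nat).

(** Bernoulli's inequality, the lower half of the squeeze in [cvg_threshold]. *)
Lemma subr1_expr_ge x k : 0 <= x <= 1 -> 1 - k%:R * x <= (1 - x) ^+ k.
Proof.
move=> /andP[x0 x1]; elim: k => [|k IH]; first by rewrite mul0r subr0 expr0.
rewrite exprSr; apply: le_trans (ler_wpM2r _ IH); last by rewrite subr_ge0.
have : 0 <= k%:R * (x * x) by rewrite !mulr_ge0.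
by rewrite -natr1; move: k%:R => K; nra.
Qed.

(** The product decreases in [k], since (1 - x)(1 + (k + 1) x) = 1 + k x - (k + 1) x^2. This is the
    upper half of the squeeze in [cvg_threshold]. *)
Lemma subr1_expr_le x k : 0 <= x <= 1 -> (1 - x) ^+ k * (1 + k%:R * x) <= 1.
Proof.
move=> /andP[x0 x1]; elim: k => [|k IH]; first by rewrite mul0r addr0 expr0 mul1r.
apply: le_trans IH; rewrite exprSr -mulrA ler_wpM2l ?exprn_ge0 ?subr_ge0//.
have : 0 <= k.+1%:R * (x * x) by rewrite !mulr_ge0.
by rewrite -natr1; move: k%:R => K; nra.
Qed.

(** Factor 1 - r^n as (1 - r)(1 + r + ... + r^(n-1)); each of the n terms is at least r^n. *)
Lemma natr_mul_expr_le r n : 0 <= r <= 1 -> n%:R * r ^+ n * (1 - r) <= 1 - r ^+ n.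
Proof.
move=> /andP[r0 r1]; elim: n => [|n IH]; first by rewrite !mul0r expr0 subrr.
rewrite -natr1 exprS; set s := r ^+ n in IH *.
have s0 : 0 <= s by exact: exprn_ge0.
have s1 : s <= 1 by exact: exprn_ile1.
set k : R := n%:R in IH *.
have : 0 <= (1 - r) * (1 - r * s).
  by rewrite mulr_ge0 ?subr_ge0 ?mulr_ile1.
by have := ler_wpM2l r0 IH; move: (k) => K; nra.
Qed.

(* Polynomials in [r] with values in [[0, 1]]: with [x = (r / 2) ^ 2n] and
   [k = n 4 ^ n], [k x = n r ^ 2n] tends to 0 for [r < 1] and to infinity for
   [1 <= r], and [1 - k x <= (1 - x) ^ k <= 1 / (1 + k x)]. *)
Lemma cvg_threshold r : 0 <= r <= 2 ->
  (fun n => (1 - (r / 2) ^+ (2 * n)) ^+ (n * 4 ^ n)) @ \oo --> ((r < 1)%R%:R : R).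
Proof.
move=> /andP[r0 r2].
have x01 n : 0 <= (r / 2) ^+ (2 * n) <= 1.
  rewrite exprn_ge0 ?divr_ge0// exprn_ile1 ?divr_ge0// ler_pdivrMr//; lra.
have kx n : (n * 4 ^ n)%:R * (r / 2) ^+ (2 * n) = n%:R * (r ^+ n * r ^+ n).
  rewrite natrM natrX !exprM -exprMn -mulrA -exprMn; congr (_ * _ ^+ _).
  by field.
have [r1|r1] := ltP r 1; last first.
  (* For 1 <= r, k x = n r^2n is at least n, so the upper bound 1 / (1 + k x) is at most 1 / (n +
     1). *)
  apply: (squeeze_cvgr _ (cvg_cst 0) (@cvg_harmonic R)).
  near=> n; rewrite exprn_ge0/=; last by rewrite subr_ge0; case/andP: (x01 n).
  rewrite /harmonic -[leRHS]mul1r ler_pdivlMr// -(natr1 n) (addrC n%:R).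
  apply: le_trans (subr1_expr_le (n * 4 ^ n) (x01 n)).
  rewrite ler_wpM2l ?exprn_ge0 ?subr_ge0//; first by case/andP: (x01 n).
  rewrite kx lerD2l ler_peMr// -expr2 -exprM exprn_ege1//.
(* For r < 1, n r^n <= 1 / (1 - r), hence n r^2n is dominated by the geometric sequence r^n / (1 -
   r). *)
rewrite mulr1n; have := @cvg_geometric R ((1 - r)^-1) r.
rewrite ger0_norm// => /(_ r1) geo.
have cl : (fun n => 1 - geometric (1 - r)^-1 r n) @ \oo --> (1 : R).
  by rewrite -[X in _ --> X]subr0; apply: cvgB; [exact: cvg_cst|exact: geo].
apply: (squeeze_cvgr _ cl); last exact: cvg_cst.
near=> n; apply/andP; split; last first.
  by apply: exprn_ile1; rewrite ?subr_ge0 ?gerBl; case/andP: (x01 n).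
apply: le_trans (subr1_expr_ge (n * 4 ^ n) (x01 n)).
rewrite kx lerD2l lerN2 /geometric /= mulrA ler_wpM2r ?exprn_ge0//.
rewrite -[leRHS]mul1r ler_pdivlMr ?subr_gt0//.
apply: le_trans (natr_mul_expr_le _ _) _; first by rewrite r0 ltW.
by rewrite gerBl exprn_ge0.
Unshelve. all: by end_near.
Qed.

End Threshold.

(** * From vanishing moments to preimages of measurable sets *)

Section Moments.
Context d (X : measurableType d) {R : realType} (mu : {measure set X -> \bar R}).
Implicit Types (D g : X -> R) (E : set X).

(** The bound is asked only where [D] is nonzero, so that weights unbounded on the whole space, such
    as exponentials, are allowed once they are bounded on the support of [D]. *)
Lemma integrable_mul_bounded E D (w : X -> R) (M : R) :
  measurable E -> mu.-integrable E (EFin \o D) -> measurable_fun E w ->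
  (forall x, D x != 0 -> `|w x| <= M) ->
  mu.-integrable E (EFin \o (fun x => D x * w x)).
Proof.
move=> mE iD mw wM.
have mD : measurable_fun E D by apply/measurable_EFinP; exact: measurable_int iD.
apply: (le_integrable mE _ _ (integrableZl mE M iD)).
  by apply/measurable_EFinP; exact: measurable_funM.
move=> x _ /=; rewrite lee_fin normrM (normrM M) mulrC.
have [->|D0] := eqVneq (D x) 0; first by rewrite normr0 !mulr0.
by rewrite ler_wpM2r// (le_trans (wM _ D0)) ?ler_norm.
Qed.

Lemma integral_horner_eq0 E D g (M : R) (p : {poly R}) :
  measurable E -> mu.-integrable E (EFin \o D) -> measurable_fun E g ->
  (forall x, D x != 0 -> `|g x| <= M) ->
  (forall k, \int[mu]_(x in E) (D x * g x ^+ k)%:E = 0)%E ->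
  (\int[mu]_(x in E) (D x * p.[g x])%:E = 0)%E.
Proof.
move=> mE iD mg gM m0.
have ik k : mu.-integrable E (EFin \o (fun x => D x * g x ^+ k)).
  apply: (@integrable_mul_bounded _ _ _ (M ^+ k)) => //.
    exact: measurable_funX.
  by move=> x /gM gx; rewrite normrX lerXn2r// nnegrE (le_trans _ gx).
transitivity (\int[mu]_(x in E) \sum_(k < size p) ((p`_k)%:E * (D x * g x ^+ k)%:E))%E.
  apply: eq_integral => x _; rewrite horner_coef mulr_sumr -sumEFin.
  by apply: eq_bigr => k _; rewrite -EFinM mulrCA.
rewrite integral_sum//; last by move=> k; exact: integrableZl (ik k).
by rewrite big1// => k _; rewrite integralZl// ?m0 ?mule0//; exact: (ik k).
Qed.

(** An affine change of variable sends [g] to [r] with values in [0, 2] on the support of [D] and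
    turns a < g into r < 1. The threshold polynomials in [r] are polynomials in [g], so they
    integrate to 0 against [D]; dominated convergence with bound |D| passes to the indicator. *)
Lemma integral_gt_eq0 E D g (M a : R) :
  measurable E -> mu.-integrable E (EFin \o D) -> measurable_fun E g ->
  (forall x, D x != 0 -> `|g x| <= M) ->
  (forall k, \int[mu]_(x in E) (D x * g x ^+ k)%:E = 0)%E ->
  (\int[mu]_(x in E `&` g @^-1` `]a, +oo[) (D x)%:E = 0)%E.
Proof.
move=> mE iD mg gM m0.
have mD : measurable_fun E D by apply/measurable_EFinP; exact: measurable_int iD.
(* A bound for |a - g| on the support of [D]; the added 1 keeps it positive. *)
pose N := `|M| + `|a| + 1.
have N0 : 0 < N by rewrite ltr_wpDl ?addr_ge0.
pose r x := 1 + (a - g x) / (2 * N).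
have r02 x : D x != 0 -> 0 <= r x <= 2.
  move=> /gM gx; have aN : `|a - g x| <= N.
    rewrite (le_trans (ler_normB _ _))// addrC (le_trans (lerD gx (lexx _)))//.
    by rewrite /N ler_wpDr// lerD2r ler_norm.
  have : `|(a - g x) / (2 * N)| <= 1 by rewrite normrM normfV (gtr0_norm (_ : 0 < 2 * N))
    ?mulr_gt0// ler_pdivrMr ?mulr_gt0// mul1r (le_trans aN)// ler_peMl ?ler1n ?ltW.
  by rewrite ler_norml /r => /andP[? ?]; apply/andP; split; lra.
have r1 x : (r x < 1) = (a < g x).
  by rewrite /r gtrDl pmulr_llt0 ?invr_gt0 ?mulr_gt0// subr_lt0.
pose q n x := (1 - (r x / 2) ^+ (2 * n)) ^+ (n * 4 ^ n).
have q0 n : (\int[mu]_(x in E) (D x * q n x)%:E = 0)%E.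
  pose l : {poly R} := (1 + a / (2 * N))%:P - (2 * N)^-1 *: 'X.
  pose p := (1 - (2^-1 *: l) ^+ (2 * n)) ^+ (n * 4 ^ n).
  rewrite -(integral_horner_eq0 p mE iD mg gM m0); apply: eq_integral => x _.
  by rewrite /p !hornerE /q /r; congr (_ * (1 - _ ^+ _) ^+ _)%:E; rewrite mulrBl; ring.
have mr : measurable_fun E r.
  apply: measurable_funD => //; apply: measurable_funM => //.
  exact: measurable_funB.
have mq n : measurable_fun E (q n).
  apply: measurable_funX; apply: measurable_funB => //; apply: measurable_funX.
  exact: measurable_funM.
have qcvg x : D x != 0 -> q n x @[n --> \oo] --> ((a < g x)%R%:R : R).
  by move=> D0; rewrite -r1; exact/cvg_threshold/r02.
have mI : measurable_fun E (fun x => (a < g x)%R%:R : R).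
  rewrite [X in measurable_fun _ X](_ : _ = \1_`]a, +oo[ \o g).
    exact: measurableT_comp.
  by apply/funext => x; rewrite /= indicE mem_setE in_itv/= andbT.
have mfn n : measurable_fun E (fun x => (D x * q n x)%:E).
  by apply/measurable_EFinP; exact: measurable_funM.
have mf : measurable_fun E (fun x => (D x * (a < g x)%R%:R)%:E).
  by apply/measurable_EFinP; exact: measurable_funM.
have := @dominated_convergence _ _ _ mu E mE
   (fun n x => (D x * q n x)%:E) (fun x => (D x * (a < g x)%R%:R)%:E)
   (fun x => (`|D x|)%:E)
   mfn mf.
move=> dom; rewrite integral_mkcondr.
have -> : (\int[mu]_(x in E) ((EFin \o D) \_ (g @^-1` `]a, +oo[)) x =
   \int[mu]_(x in E) (D x * (a < g x)%R%:R)%:E)%E.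
  apply: eq_integral => x _; rewrite patchE.
  have -> : (x \in g @^-1` `]a, +oo[) = (a < g x).
    by apply/idP/idP; rewrite inE/= in_itv/= andbT.
  by case: ifP => _; rewrite ?mulr1 ?mulr0.
case: dom.
- apply/aeW => x _; apply: cvg_EFin; first exact: nearW.
  (* Where [D] vanishes, [r] may leave [0, 2] and [q] need not converge, but the product is
     constantly 0. *)
  have [D0|/qcvg qx] := eqVneq (D x) 0; last exact: cvgMr.
  by rewrite /comp/= D0 mul0r; under eq_fun do rewrite mul0r; exact: cvg_cst.
- exact: (integrable_norm iD).
- apply/aeW => x n _; rewrite lee_fin normrM.
  have [->|D0] := eqVneq (D x) 0; first by rewrite normr0 mul0r.
  rewrite ler_piMr//; have /andP[rx0 rx2] := r02 _ D0.
  have rn : 0 <= (r x / 2) ^+ (2 * n) <= 1.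
    rewrite exprn_ge0 ?divr_ge0// exprn_ile1 ?divr_ge0// ler_pdivrMr//; lra.
  case/andP: rn => ? ?; rewrite ger0_norm ?exprn_ge0 ?subr_ge0//.
  by rewrite exprn_ile1 ?subr_ge0// gerBl.
move=> _ _; under eq_fun do rewrite q0.
by move/(cvg_unique (@ereal_hausdorff R) (cvg_cst 0%E)).
Qed.

Section Dynkin.
Context d' (Y : measurableType d').
Implicit Types G : set_system Y.

(** The sets [B] satisfying the conclusion form a Dynkin system: the whole space by the assumption
    on [E], complements by subtraction, disjoint unions by countable additivity. *)
Lemma integral_preimage_eq0 G E D (g : X -> Y) :
  measurable E -> mu.-integrable E (EFin \o D) -> measurable_fun E g ->
  @measurable _ Y = <<s G >> -> setI_closed G ->
  (\int[mu]_(x in E) (D x)%:E = 0)%E ->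
  (forall B, G B -> \int[mu]_(x in E `&` g @^-1` B) (D x)%:E = 0)%E ->
  forall B, measurable B -> (\int[mu]_(x in E `&` g @^-1` B) (D x)%:E = 0)%E.
Proof.
move=> mE iD mg sG IG D0 GD0 B; rewrite sG; move: B.
have mD : measurable_fun E D by apply/measurable_EFinP; exact: measurable_int iD.
have mgB B : measurable B -> measurable (E `&` g @^-1` B) by exact: mg.
apply: (dynkin_induction sG IG) => //.
- by rewrite preimage_setT setIT.
- move=> B mB B0.
  have EE : E = (E `&` g @^-1` B) `|` (E `&` g @^-1` (~` B)).
    by rewrite -setIUr preimage_setC setUv setIT.
  move: D0; rewrite {1}EE integral_setU ?B0 ?add0e//.
  + exact: mgB.
  + by apply: mgB; exact: measurableC.
  + by rewrite -EE; apply/measurable_EFinP.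
  + by apply/disj_setPS => x [[_ ?] [_]].
- move=> F mF tF F0.
  have -> : E `&` g @^-1` (\bigcup_k F k) = \bigcup_k (E `&` g @^-1` F k).
    by rewrite preimage_bigcup setI_bigcupr.
  rewrite integral_bigcup.
  + by apply: eseries0 => k _ _.
  + apply/trivIsetP => i j _ _ ij; move/trivIsetP : tF => /(_ i j I I ij) Fij.
    by apply/seteqP; split => // x [[_ Fi] [_ Fj]]; have : (F i `&` F j) (g x) by []; rewrite Fij.
  + by move=> k; exact: mgB.
  + apply: integrableS iD => //; first by apply: bigcup_measurable => k _; exact: mgB.
    by move=> x [k _ []].
Qed.

End Dynkin.

(** The half-lines treated in [integral_gt_eq0] generate the Borel sets and are stable under
    intersection; the moment of order 0 is the integral over [E]. *)
Lemma integral_moments_eq0 E D (g : X -> R) (M : R) :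
  measurable E -> mu.-integrable E (EFin \o D) -> measurable_fun E g ->
  (forall x, D x != 0 -> `|g x| <= M) ->
  (forall k, \int[mu]_(x in E) (D x * g x ^+ k)%:E = 0)%E ->
  forall B, measurable B -> (\int[mu]_(x in E `&` g @^-1` B) (D x)%:E = 0)%E.
Proof.
move=> mE iD mg gM m0; apply: (integral_preimage_eq0 (G := @RGenOInfty.G R)) => //.
- exact: RGenOInfty.measurableE.
- move=> _ _ [a ->] [b ->]; exists (Num.max a b); apply/seteqP; split=> x /=.
    by rewrite !in_itv/= !andbT gt_max => -[-> ->].
  by rewrite !in_itv/= !andbT gt_max => /andP.
- by rewrite -(m0 0); apply: eq_integral => x _; rewrite expr0 mulr1.
- by move=> _ [a ->]; exact: integral_gt_eq0 gM m0.
Qed.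

(** Measurable rectangles form an intersection-stable generator of the product sigma-algebra. *)
Lemma integral_preimage_pair_eq0 d1 d2 (Y1 : measurableType d1)
    (Y2 : measurableType d2) E D (g1 : X -> Y1) (g2 : X -> Y2) :
  measurable E -> mu.-integrable E (EFin \o D) ->
  measurable_fun setT g1 -> measurable_fun setT g2 ->
  (forall B1 B2, measurable B1 -> measurable B2 ->
    \int[mu]_(x in E `&` g1 @^-1` B1 `&` g2 @^-1` B2) (D x)%:E = 0)%E ->
  forall B, measurable B ->
    (\int[mu]_(x in E `&` (fun x => (g1 x, g2 x)) @^-1` B) (D x)%:E = 0)%E.
Proof.
move=> mE iD mg1 mg2 B0.
apply: (integral_preimage_eq0
  (G := [set A `*` B | A in @measurable _ Y1 & B in @measurable _ Y2])) => //.
- exact/measurable_funTS/measurable_fun_pair.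
- exact: measurable_prod_measurableType.
- move=> _ _ [A1 mA1 [B1 mB1 <-]] [A2 mA2 [B2 mB2 <-]].
  exists (A1 `&` A2); first exact: measurableI.
  by exists (B1 `&` B2); [exact: measurableI|rewrite setXI].
- by have := B0 _ _ measurableT measurableT; rewrite !preimage_setT !setIT.
- by move=> _ [A mA [B mB <-]]; rewrite -(B0 _ _ mA mB) setIA.
Qed.

End Moments.

(** * Exponential and trigonometric moments *)

Section TrigBounds.
Context {R : realType}.

Lemma measurable_cos : measurable_fun setT (@cos R).
Proof. by apply: continuous_measurable_fun; exact: continuous_cos. Qed.

Lemma measurable_sin : measurable_fun setT (@sin R).
Proof. by apply: continuous_measurable_fun; exact: continuous_sin. Qed.

Lemma norm_cos_le1 (x : R) : `|cos x| <= 1.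
Proof. by rewrite ler_norml cos_geN1 cos_le1. Qed.

Lemma norm_sin_le1 (x : R) : `|sin x| <= 1.
Proof. by rewrite ler_norml sin_geN1 sin_le1. Qed.

End TrigBounds.

Section ExpTrig.
Context d (X : measurableType d) {R : realType} (mu : {measure set X -> \bar R}).
Implicit Types (D s th : X -> R) (E : set X).

(* A phase [a] is carried along so that multiplying by [cos (th + b)] stays in
   the same family: 2 cos u cos v = cos (u + v) + cos (v - u). *)
Lemma integral_prod_cos_eq0 D th :
  mu.-integrable setT (EFin \o D) -> measurable_fun setT th ->
  (forall n : int, \int[mu]_x (D x * cos (n%:~R * th x))%:E = 0)%E ->
  (forall n : int, \int[mu]_x (D x * sin (n%:~R * th x))%:E = 0)%E ->
  forall (bs : seq R) (n : int) (a : R),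
  (\int[mu]_x (D x * ((\prod_(b <- bs) cos (th x + b)) *
                      cos (n%:~R * th x + a)))%:E = 0)%E.
Proof.
move=> iD mth C0 S0; elim=> [|b bs IH] n a.
  have mn : measurable_fun setT (fun x => n%:~R * th x) by exact: measurable_funM.
  have iC : mu.-integrable setT (EFin \o (fun x => D x * cos (n%:~R * th x))).
    apply: (integrable_mul_bounded (M := 1)) => //; last by move=> *; exact: norm_cos_le1.
    exact: measurableT_comp measurable_cos mn.
  have iS : mu.-integrable setT (EFin \o (fun x => D x * sin (n%:~R * th x))).
    apply: (integrable_mul_bounded (M := 1)) => //; last by move=> *; exact: norm_sin_le1.
    exact: measurableT_comp measurable_sin mn.
  transitivity (\int[mu]_x ((cos a)%:E * (D x * cos (n%:~R * th x))%:E
                  - (sin a)%:E * (D x * sin (n%:~R * th x))%:E))%E.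
    apply: eq_integral => x _; rewrite big_nil mul1r -!EFinM -EFinB cosD.
    by congr _%:E; ring.
  rewrite integralB//; [|exact: integrableZl iC|exact: integrableZl iS].
  by rewrite !integralZl// C0 S0 !mule0 sube0.
pose P x := \prod_(b <- bs) cos (th x + b).
have mP : measurable_fun setT P.
  rewrite /P; elim: bs {IH P} => [|e bs IHb].
    by under eq_fun do rewrite big_nil; exact: measurable_cst.
  under eq_fun do rewrite big_cons; apply: measurable_funM => //.
  by apply: measurableT_comp measurable_cos _; exact: measurable_funD.
have P1 x : `|P x| <= 1.
  rewrite /P; elim: bs {IH mP P} => [|e bs IHb]; first by rewrite big_nil normr1.
  by rewrite big_cons normrM mulr_ile1// norm_cos_le1.
have iC (m : int) e : mu.-integrable setT (EFin \o (fun x =>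
    D x * (P x * cos (m%:~R * th x + e)))).
  apply: (integrable_mul_bounded (M := 1)) => //; last first.
    by move=> x _; rewrite normrM mulr_ile1// norm_cos_le1.
  apply: measurable_funM => //; apply: measurableT_comp measurable_cos _.
  by apply: measurable_funD => //; exact: measurable_funM.
transitivity (\int[mu]_x ((2^-1)%:E * (D x * (P x * cos ((n + 1)%:~R * th x + (a + b))))%:E
  + (2^-1)%:E * (D x * (P x * cos ((n - 1)%:~R * th x + (a - b))))%:E))%E.
  apply: eq_integral => x _; rewrite big_cons -/(P x) -!EFinM -EFinD; congr _%:E.
  have -> : (n + 1)%:~R * th x + (a + b) = (n%:~R * th x + a) + (th x + b).
    by rewrite intrD; ring.
  have -> : (n - 1)%:~R * th x + (a - b) = (n%:~R * th x + a) - (th x + b).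
    by rewrite intrB; ring.
  by rewrite cosB (cosD (_ + a)); field.
rewrite integralD//; [|exact: integrableZl (iC _ _)|exact: integrableZl (iC _ _)].
rewrite (integralZl _ (iC _ _))// (integralZl _ (iC _ _))//.
by rewrite (IH (n + 1) (a + b)) (IH (n - 1) (a - b)) !mule0 adde0.
Qed.

(** Since sin t = cos (t - pi / 2), the monomial is a product of cosines with shifts 0 and - pi /
    2. *)
Lemma integral_cosX_sinX_eq0 D th :
  mu.-integrable setT (EFin \o D) -> measurable_fun setT th ->
  (forall n : int, \int[mu]_x (D x * cos (n%:~R * th x))%:E = 0)%E ->
  (forall n : int, \int[mu]_x (D x * sin (n%:~R * th x))%:E = 0)%E ->
  forall k l, (\int[mu]_x (D x * (cos (th x) ^+ k * sin (th x) ^+ l))%:E = 0)%E.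
Proof.
move=> iD mth C0 S0 k l.
rewrite -[RHS](integral_prod_cos_eq0 iD mth C0 S0 (nseq k 0 ++ nseq l (- (pi / 2))) 0 0).
apply: eq_integral => x _; rewrite mul0r addr0 cos0 mulr1 big_cat/=; congr (_ * (_ * _))%:E.
  by rewrite big_nseq iter_mulr_1 addr0.
by rewrite big_nseq iter_mulr_1 cosBpihalf.
Qed.

(** Powers are traded for preimages one coordinate at a time: first the exponential, with the
    density multiplied by a fixed trigonometric monomial; then the cosine, with a fixed power of the
    sine; the sine last. *)
Lemma integral_preimage_exp_trig_eq0 D s th (M : R) :
  mu.-integrable setT (EFin \o D) -> measurable_fun setT s -> measurable_fun setT th ->
  (forall x, D x != 0 -> `|s x| <= M) ->
  (forall (m : nat) (n : int),
    \int[mu]_x (D x * expR (s x) ^+ m * cos (n%:~R * th x))%:E = 0)%E ->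
  (forall (m : nat) (n : int),
    \int[mu]_x (D x * expR (s x) ^+ m * sin (n%:~R * th x))%:E = 0)%E ->
  forall B, measurable B ->
  (\int[mu]_(x in (fun x => (expR (s x), (cos (th x), sin (th x)))) @^-1` B)
     (D x)%:E = 0)%E.
Proof.
move=> iD ms mth sM C0 S0.
have me : measurable_fun setT (fun x => expR (s x)) by exact: measurableT_comp.
have mc : measurable_fun setT (fun x => cos (th x)).
  exact: measurableT_comp measurable_cos mth.
have msi : measurable_fun setT (fun x => sin (th x)).
  exact: measurableT_comp measurable_sin mth.
have eM x : D x != 0 -> `|expR (s x)| <= expR M.
  by move=> /sM sxM; rewrite (ger0_norm (expR_ge0 _)) ler_expR (le_trans (ler_norm _)).
have iDe (m : nat) : mu.-integrable setT (EFin \o (fun x => D x * expR (s x) ^+ m)).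
  apply: (integrable_mul_bounded (M := expR M ^+ m)) => //; first exact: measurable_funX.
  by move=> x /eM ?; rewrite normrX lerXn2r// nnegrE expR_ge0.
have iDcs k l : mu.-integrable setT (EFin \o (fun x => D x * (cos (th x) ^+ k * sin (th x) ^+ l))).
  apply: (integrable_mul_bounded (M := 1)) => //.
    by apply: measurable_funM; exact: measurable_funX.
  by move=> x _; rewrite normrM !normrX mulr_ile1// exprn_ile1// ?norm_cos_le1 ?norm_sin_le1.
suff trig B1 : measurable B1 -> forall B2, measurable B2 ->
    (\int[mu]_(x in (fun x => expR (s x)) @^-1` B1 `&`
        (fun x => (cos (th x), sin (th x))) @^-1` B2) (D x)%:E = 0)%E.
  move=> B mB; rewrite -[X in (\int[_]_(x in X) _)%E]setTI.
  apply: integral_preimage_pair_eq0 => //; first exact: measurable_fun_pair.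
  by move=> B1 B2 mB1 mB2; rewrite setTI; exact: trig.
move=> mB1.
have mE1 : measurable ((fun x => expR (s x)) @^-1` B1).
  by rewrite -[X in measurable X]setTI; exact: me.
have cs0 k l : (\int[mu]_(x in (fun x => expR (s x)) @^-1` B1)
    (D x * (cos (th x) ^+ k * sin (th x) ^+ l))%:E = 0)%E.
  rewrite -[X in (\int[_]_(x in X) _)%E]setTI.
  apply: (integral_moments_eq0 (M := expR M)) => //.
    by move=> x Dx; apply: eM; apply: contraNneq Dx => ->; rewrite mul0r.
  move=> m; rewrite -(integral_cosX_sinX_eq0 (iDe m) mth (C0 m) (S0 m) k l).
  by apply: eq_integral => x _; congr _%:E; ring.
have iD1 : mu.-integrable ((fun x => expR (s x)) @^-1` B1) (EFin \o D).
  exact: integrableS iD.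
apply: integral_preimage_pair_eq0 => // B2 B3 mB2 mB3.
have mE2 : measurable ((fun x => expR (s x)) @^-1` B1 `&` (fun x => cos (th x)) @^-1` B2).
  by apply: measurableI => //; rewrite -[X in measurable X]setTI; exact: mc.
apply: (integral_moments_eq0 (M := 1)) => //.
- exact: integrableS iD.
- exact: measurable_funTS.
- by move=> x _; exact: norm_sin_le1.
move=> l; apply: (integral_moments_eq0 (M := 1)) => //.
- apply: (@integrableS _ _ _ _ setT) => //; apply: eq_integrable (iDcs 0%N l) => // x _ /=.
  by rewrite expr0 mul1r.
- exact: measurable_funTS.
- by move=> x _; exact: norm_cos_le1.
- by move=> k; rewrite -(cs0 k l); apply: eq_integral => x _; congr _%:E; ring.
Qed.

End ExpTrig.

(** * Inverting the exponential and trigonometric coordinates on the open square *)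

Section Rectangles.
Context {R : realType}.

(* The inverse [1 / (1 + cos x)] is written [expR (- ln (1 + cos x))] so that
   measurability in [cos x] is immediate. *)
Lemma atan_half_angle (x : R) : - pi < x < pi ->
  2 * atan (sin x * expR (- ln (1 + cos x))) = x.
Proof.
move=> /andP[x1 x2]; pose y := x / 2.
have xy : x = y *+ 2 by rewrite /y mulr2n -splitr.
have yI : - (pi / 2) < y < pi / 2.
  by rewrite /y -mulNr ltr_pM2r// x1/= ltr_pM2r.
have cy : 0 < cos y by exact: cos_gt0_pihalf.
have cE : 1 + cos x = cos y ^+ 2 *+ 2 by rewrite xy cos_mulr2n addrC subrK.
have c0 : 0 < 1 + cos x by rewrite cE pmulrn_lgt0// exprn_gt0.
rewrite expRN lnK ?posrE// cE [in sin _]xy sin_mulr2n.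
have -> : (cos y * sin y) *+ 2 / (cos y ^+ 2 *+ 2) = tan y.
  by rewrite /tan; field; exact: lt0r_neq0.
by rewrite tanK ?in_itv//= mulrC /y divfK.
Qed.

Local Notation T := (measurableTypeR R).

Lemma integral_rect_eq0 (mu : {measure set (T * T) -> \bar R}) (D : T * T -> R)
    (c l : R) :
  0 < c -> 0 < l -> mu.-integrable setT (EFin \o D) ->
  (forall x, D x != 0 -> `|x.1 : R| < c / 2 /\ `|x.2 : R| < c / 2) ->
  (forall (m : nat) (n : int), \int[mu]_x
    (D x * expR (l * ((x.1 : R) + x.2)) ^+ m * cos (n%:~R * (pi / c * ((x.1 : R) - x.2))))%:E = 0)%E ->
  (forall (m : nat) (n : int), \int[mu]_x
    (D x * expR (l * ((x.1 : R) + x.2)) ^+ m * sin (n%:~R * (pi / c * ((x.1 : R) - x.2))))%:E = 0)%E ->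
  forall A1 A2, measurable A1 -> measurable A2 ->
    (\int[mu]_(x in A1 `*` A2) (D x)%:E = 0)%E.
Proof.
move=> c0 l0 iD Dc C0 S0 A1 A2 mA1 mA2.
have pi0 : 0 < pi :> R by exact: pi_gt0.
pose sum (z : R * (R * R)) := ln z.1 / l.
pose diff (z : R * (R * R)) :=
  c / pi * (2 * atan (z.2.2 * expR (- ln (1 + z.2.1)))).
pose Psi z : T * T := ((sum z + diff z) / 2, (sum z - diff z) / 2).
have msum : measurable_fun setT sum.
  by apply: measurable_funM => //; exact: measurableT_comp.
have mdiff : measurable_fun setT diff.
  apply: measurable_funM => //; apply: measurable_funM => //.
  apply: (measurableT_comp (f := @atan R)).
    by apply: continuous_measurable_fun; exact: continuous_atan.
  apply: measurable_funM; first exact: measurableT_comp.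
  apply: measurableT_comp => //; apply: measurableT_comp => //.
  apply: measurableT_comp => //; apply: measurable_funD => //.
  exact: measurableT_comp.
have mPsi : measurable_fun setT Psi.
  apply: measurable_fun_pair; apply: measurable_funM => //.
    exact: measurable_funD.
  exact: measurable_funB.
have mB : measurable (Psi @^-1` (A1 `*` A2)).
  by rewrite -[X in measurable X]setTI; apply: mPsi => //; exact: measurableX.
have mf1 : measurable_fun setT (fun x : T * T => x.1 : R) by exact: measurable_fst.
have mf2 : measurable_fun setT (fun x : T * T => x.2 : R) by exact: measurable_snd.
rewrite -[RHS](integral_preimage_exp_trig_eq0 (M := l * c) iD _ _ _ C0 S0 mB); last first.
- move=> x /Dc[x1 x2]; rewrite normrM gtr0_norm// ler_pM2l//.
  by rewrite (le_trans (ler_normD _ _))// (splitr c) lerD// ltW.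
- by apply: measurable_funM => //; exact: measurable_funB.
- by apply: measurable_funM => //; exact: measurable_funD.
rewrite [LHS]integral_mkcond [RHS]integral_mkcond; apply: eq_integral => x _.
rewrite !patchE; have [D0|/Dc[x1 x2]] := eqVneq (D x) 0.
  by rewrite /= D0; do 2 case: ifP.
suff PK : Psi (expR (l * (x.1 + x.2)), (cos (pi / c * (x.1 - x.2)), sin (pi / c * (x.1 - x.2)))) = x.
  have AP := congr1 (A1 `*` A2) PK.
  congr (if _ then _ else _); apply/idP/idP => /set_mem Ax; apply/mem_set.
    exact: (eq_ind_r id Ax AP).
  exact: (eq_ind _ id Ax _ AP).
(* Strictness of the bounds on both coordinates keeps the angle off the endpoints - pi and pi, as
   [atan_half_angle] requires. *)
have dI : - pi < pi / c * (x.1 - x.2) < pi.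
  rewrite -ltr_norml normrM gtr0_norm ?divr_gt0// mulrAC ltr_pdivrMr// ltr_pM2l//.
  by rewrite (le_lt_trans (ler_normB _ _))// (splitr c) ltrD.
have -> : x = (x.1, x.2) by case: (x).
rewrite /Psi /sum /diff /= expRK atan_half_angle//.
have -> : c / pi * (pi / c * (x.1 - x.2)) = x.1 - x.2.
  by rewrite mulrA mulf_div (mulrC c) divff ?mul1r// mulf_neq0 ?gt_eqF.
by congr pair; field; rewrite gt_eqF.
Qed.

End Rectangles.

(** * Tensor products and the phase *)

Section Tensors.
Context {R : realType}.
Local Notation mu := (@lebesgue_measure R).
Implicit Types p q : R -> R.

Lemma integrable_prod p q :
  mu.-integrable setT (EFin \o p) -> mu.-integrable setT (EFin \o q) ->
  (mu \x mu)%E.-integrable setT (EFin \o (fun z => p z.1 * q z.2)).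
Proof.
move=> ip iq.
have mp : measurable_fun setT p by apply/measurable_EFinP; exact: measurable_int ip.
have mq : measurable_fun setT q by apply/measurable_EFinP; exact: measurable_int iq.
apply/integrable12ltyP.
  by apply/measurable_EFinP; apply: measurable_funM; exact: measurableT_comp.
have iq' := integrable_norm iq; have ip' := integrable_norm ip.
under eq_integral => x _.
  rewrite (_ : (\int[mu]_y _)%E =
    ((fine (\int[mu]_y (`|q y|)%:E)%E)%:E * (`|p x|)%:E)%E); last first.
    rewrite fineK; last exact: integrable_fin_num.
    rewrite muleC -integralZl//; apply: eq_integral => y _.
    by rewrite /= normrM EFinM.
  over.
rewrite integralZl//; apply: lte_mul_pinfty => //; last exact: integrable_lty.
by rewrite lee_fin fine_ge0// integral_ge0.
Qed.

Lemma integral_prod p q :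
  mu.-integrable setT (EFin \o p) -> mu.-integrable setT (EFin \o q) ->
  (\int[mu \x mu]_z (p z.1 * q z.2)%:E =
   ((\int[mu]_x p x) * (\int[mu]_x q x))%:E)%E.
Proof.
move=> ip iq; rewrite -integral12_prod_meas1; last exact: integrable_prod.
rewrite /fubini_F/=.
under eq_integral => x _.
  rewrite (_ : (\int[mu]_y _)%E = ((\int[mu]_y q y)%:E * (p x)%:E)%E); last first.
    rewrite /Rintegral fineK; last exact: integrable_fin_num.
    by rewrite muleC -integralZl.
  over.
rewrite integralZl// mulrC EFinM; congr (_ * _)%E.
by rewrite /Rintegral fineK//; exact: integrable_fin_num.
Qed.

Lemma integrable_mul_expR_bounded p (w : R -> R) (c l : R) (m : nat) :
  0 < c -> 0 < l -> mu.-integrable setT (EFin \o p) ->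
  (forall x, p x != 0 -> `|x| < c / 2) ->
  measurable_fun setT w -> (forall x, `|w x| <= 1) ->
  mu.-integrable setT (EFin \o (fun x => p x * (expR (l * x) ^+ m * w x))).
Proof.
move=> c0 l0 ip pc mw w1.
apply: (integrable_mul_bounded (M := expR (l * (c / 2)) ^+ m)) => //.
  apply: measurable_funM => //; apply: measurable_funX.
  by apply: measurableT_comp => //; exact: measurable_funM.
move=> x /pc xc; rewrite normrM -[leRHS]mulr1 ler_pM//.
rewrite ger0_norm ?exprn_ge0 ?expR_ge0// lerXn2r ?nnegrE ?expR_ge0//.
by rewrite ler_expR ler_pM2l// (le_trans (ler_norm _))// ltW.
Qed.

Context (k : nat) (e : 'I_k -> R).
Implicit Types u v : 'I_k -> R -> R.

Lemma integrable_tensor u v :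
  (forall i, mu.-integrable setT (EFin \o u i)) ->
  (forall i, mu.-integrable setT (EFin \o v i)) ->
  (mu \x mu)%E.-integrable setT (EFin \o (fun z => \sum_i e i * (u i z.1 * v i z.2))).
Proof.
move=> iu iv.
rewrite (_ : _ \o _ = fun z => (\sum_i (e i)%:E * (u i z.1 * v i z.2)%:E)%E); last first.
  by apply/funext => z /=; rewrite sumEFin.
by apply: integrable_sum => // i _; exact: integrableZl (integrable_prod (iu i) (iv i)).
Qed.

Lemma integral_tensor u v :
  (forall i, mu.-integrable setT (EFin \o u i)) ->
  (forall i, mu.-integrable setT (EFin \o v i)) ->
  (\int[mu \x mu]_z (\sum_i e i * (u i z.1 * v i z.2))%:E =
   (\sum_i e i * ((\int[mu]_x u i x) * (\int[mu]_x v i x)))%:E)%E.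
Proof.
move=> iu iv; under eq_integral do rewrite -sumEFin.
rewrite integral_sum//; last first.
  by move=> i; exact: integrableZl (integrable_prod (iu i) (iv i)).
rewrite -sumEFin; apply: eq_bigr => i _.
by rewrite (integralZl _ (integrable_prod (iu i) (iv i)))// integral_prod.
Qed.

(** For D = sum of e_i u_i(x) v_i(y), the exponential of the sum factorises and the addition
    formulas split the cosine and sine of the difference. The two hypotheses are therefore the
    vanishing of the cosine and sine moments of [D]. The signs [e] let the same statement serve for
    real and imaginary parts. *)
Lemma integral_tensor_rect_eq0 u v (c l : R) :
  0 < c -> 0 < l ->
  (forall i, mu.-integrable setT (EFin \o u i)) ->
  (forall i, mu.-integrable setT (EFin \o v i)) ->
  (forall i x, u i x != 0 -> `|x| < c / 2) ->
  (forall i x, v i x != 0 -> `|x| < c / 2) ->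
  let C (m : nat) (n : int) p :=
    \int[mu]_x (p x * (expR (l * x) ^+ m * cos (n%:~R * (pi / c * x)))) in
  let S (m : nat) (n : int) p :=
    \int[mu]_x (p x * (expR (l * x) ^+ m * sin (n%:~R * (pi / c * x)))) in
  (forall m n, \sum_i e i * (C m n (u i) * C m n (v i) + S m n (u i) * S m n (v i)) = 0) ->
  (forall m n, \sum_i e i * (S m n (u i) * C m n (v i) - C m n (u i) * S m n (v i)) = 0) ->
  forall A1 A2, measurable A1 -> measurable A2 ->
  \sum_i e i * ((\int[mu]_(x in A1) u i x) * (\int[mu]_(x in A2) v i x)) = 0.
Proof.
move=> c0 l0 iu iv uc vc C S CS0 SC0 A1 A2 mA1 mA2.
pose wc (m : nat) (n : int) x : R := expR (l * x) ^+ m * cos (n%:~R * (pi / c * x)).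
pose ws (m : nat) (n : int) x : R := expR (l * x) ^+ m * sin (n%:~R * (pi / c * x)).
have mc (n : int) : measurable_fun setT (fun x : R => cos (n%:~R * (pi / c * x))).
  by apply: measurableT_comp measurable_cos _; do 2 apply: measurable_funM => //.
have ms (n : int) : measurable_fun setT (fun x : R => sin (n%:~R * (pi / c * x))).
  by apply: measurableT_comp measurable_sin _; do 2 apply: measurable_funM => //.
have iC p m n : mu.-integrable setT (EFin \o p) -> (forall x, p x != 0 -> `|x| < c / 2) ->
    mu.-integrable setT (EFin \o (fun x => p x * wc m n x)).
  by move=> ip pc; apply: (integrable_mul_expR_bounded m c0 l0 ip pc (mc n)) => x; exact: norm_cos_le1.
have iS p m n : mu.-integrable setT (EFin \o p) -> (forall x, p x != 0 -> `|x| < c / 2) ->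
    mu.-integrable setT (EFin \o (fun x => p x * ws m n x)).
  by move=> ip pc; apply: (integrable_mul_expR_bounded m c0 l0 ip pc (ms n)) => x; exact: norm_sin_le1.
pose D (z : measurableTypeR R * measurableTypeR R) := \sum_i e i * (u i z.1 * v i z.2).
have iD := integrable_tensor iu iv.
have Dc x : D x != 0 -> `|x.1 : R| < c / 2 /\ `|x.2 : R| < c / 2.
  move=> D0; have [i uvi] : exists i, e i * (u i x.1 * v i x.2) != 0.
    apply/not_existsP => uv0; move/eqP : D0; apply; apply: big1 => i _.
    by apply/eqP/negPn/negP; exact: uv0.
  by move: uvi; rewrite !mulf_eq0 !negb_or => /andP[_ /andP[/uc ? /vc ?]].
have := integral_rect_eq0 c0 l0 iD Dc.
have iuC := fun m n i => iC _ m n (iu i) (uc i).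
have iuS := fun m n i => iS _ m n (iu i) (uc i).
have ivC := fun m n i => iC _ m n (iv i) (vc i).
have ivS := fun m n i => iS _ m n (iv i) (vc i).
have eD (a b : R) m : expR (l * (a + b)) ^+ m = expR (l * a) ^+ m * expR (l * b) ^+ m.
  by rewrite mulrDr expRD exprMn.
have iA p A : measurable A -> mu.-integrable setT (EFin \o p) ->
    mu.-integrable setT (EFin \o (p \_ A)).
  move=> mA ip; rewrite patch_indic; apply: (integrable_mul_bounded (M := 1)) => //.
  by move=> x _; rewrite indicE normr_nat; case: (_ \in _).
(* Cutting each factor to its side turns the integral over the rectangle into a tensor integral over
   the plane. *)
have rect : (\int[mu \x mu]_(x in A1 `*` A2) (D x)%:E =
   (\sum_i e i * ((\int[mu]_(x in A1) u i x) * (\int[mu]_(x in A2) v i x)))%:E)%E.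
  rewrite integral_mkcond.
  under eq_bigr do rewrite Rintegral_mkcond (Rintegral_mkcond _ A2).
  rewrite -integral_tensor; [|by move=> i; exact: iA..].
  apply: eq_integral => x _; rewrite patchE in_setX /D.
  have [x1|x1] := boolP (x.1 \in A1); have [x2|x2] := boolP (x.2 \in A2) => /=;
    last 3 first.
  - by rewrite big1// => i _; rewrite !patchE (negbTE x2) !mulr0.
  - by rewrite big1// => i _; rewrite !patchE (negbTE x1) mul0r mulr0.
  - by rewrite big1// => i _; rewrite !patchE (negbTE x1) mul0r mulr0.
  by congr _%:E; apply: eq_bigr => i _; rewrite !patchE x1 x2.
move=> /(_ _ _ A1 A2 mA1 mA2); rewrite rect => H.
apply/EFin_inj; apply: H => m n.
- transitivity (\int[mu \x mu]_z ((\sum_i e i * ((u i z.1 * wc m n z.1) * (v i z.2 * wc m n z.2)))%:E +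
     (\sum_i e i * ((u i z.1 * ws m n z.1) * (v i z.2 * ws m n z.2)))%:E))%E.
    apply: eq_integral => z _; rewrite -EFinD -big_split/= !mulr_suml; congr _%:E.
    apply: eq_bigr => i _.
    by rewrite eD 2!mulrBr cosB /wc /ws; ring.
  rewrite integralD//; [|exact: integrable_tensor (iuC m n) (ivC m n)
                        |exact: integrable_tensor (iuS m n) (ivS m n)].
  rewrite (integral_tensor (iuC m n) (ivC m n)) (integral_tensor (iuS m n) (ivS m n)).
  rewrite -EFinD -big_split/= -[RHS]/(0%:E); congr _%:E.
  by rewrite -[RHS](CS0 m n); apply: eq_bigr => i _; rewrite mulrDr.
- transitivity (\int[mu \x mu]_z ((\sum_i e i * ((u i z.1 * ws m n z.1) * (v i z.2 * wc m n z.2)))%:E -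
     (\sum_i e i * ((u i z.1 * wc m n z.1) * (v i z.2 * ws m n z.2)))%:E))%E.
    apply: eq_integral => z _; rewrite -EFinB -sumrB/= !mulr_suml; congr _%:E.
    apply: eq_bigr => i _.
    by rewrite eD 2!mulrBr sinB /wc /ws; ring.
  rewrite integralB//; [|exact: integrable_tensor (iuS m n) (ivC m n)
                        |exact: integrable_tensor (iuC m n) (ivS m n)].
  rewrite (integral_tensor (iuS m n) (ivC m n)) (integral_tensor (iuC m n) (ivS m n)).
  rewrite -EFinB -sumrB/= -[RHS]/(0%:E); congr _%:E.
  by rewrite -[RHS](SC0 m n); apply: eq_bigr => i _; rewrite mulrBr.
Qed.

End Tensors.

(** * From the sampled moduli to the kernel F (x) conj F *)

Section Phase.
Context {R : realType}.
Local Notation mu := (@lebesgue_measure R).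
Implicit Types p q : R -> R.

(** With F = p1 + i p2, the numbers C p1 + S p2 and C p2 - S p1 are the real and imaginary parts of
    the integral of F(x) exp (m l x) exp (- i n pi x / c). The conclusions are the real part of F(A)
    conj F(B) and, up to sign, its imaginary part. *)
Lemma eq_modulus_tensor p1 p2 q1 q2 (c l : R) : 0 < c -> 0 < l ->
  (forall p, p \in [:: p1; p2; q1; q2] ->
    mu.-integrable setT (EFin \o p) /\ forall x, p x != 0 -> `|x| < c / 2) ->
  let C (m : nat) (n : int) p :=
    \int[mu]_x (p x * (expR (l * x) ^+ m * cos (n%:~R * (pi / c * x)))) in
  let S (m : nat) (n : int) p :=
    \int[mu]_x (p x * (expR (l * x) ^+ m * sin (n%:~R * (pi / c * x)))) in
  (forall m n, (C m n p1 + S m n p2) ^+ 2 + (C m n p2 - S m n p1) ^+ 2 =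
               (C m n q1 + S m n q2) ^+ 2 + (C m n q2 - S m n q1) ^+ 2) ->
  let I A p := \int[mu]_(x in A) p x in
  forall A B, measurable A -> measurable B ->
  I A p1 * I B p1 + I A p2 * I B p2 = I A q1 * I B q1 + I A q2 * I B q2 /\
  I A p1 * I B p2 - I A p2 * I B p1 = I A q1 * I B q2 - I A q2 * I B q1.
Proof.
move=> c0 l0 ip C S CS I A B mA mB.
have CN m n p : C m (- n) p = C m n p.
  by apply: eq_Rintegral => x _; rewrite intrN mulNr cosN.
have ms (n : int) : measurable_fun setT (fun x : R => sin (n%:~R * (pi / c * x))).
  by apply: measurableT_comp measurable_sin _; do 2 apply: measurable_funM => //.
have SN m n p : p \in [:: p1; p2; q1; q2] -> S m (- n) p = - S m n p.
  move=> /ip[ip0 pc].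
  have iS := integrable_mul_expR_bounded m c0 l0 ip0 pc (ms n) (fun x => norm_sin_le1 _).
  apply: etrans (etrans (RintegralZl (-1) measurableT iS) (mulN1r _)).
  by apply: eq_Rintegral => x _; rewrite intrN mulNr sinN; ring.
have ips (s : seq (R -> R)) : {subset s <= [:: p1; p2; q1; q2]} -> forall i : 'I_(size s),
    mu.-integrable setT (EFin \o nth p1 s i) /\ forall x, nth p1 s i x != 0 -> `|x| < c / 2.
  by move=> ss i; apply/ip/ss/mem_nth.
have sub0 : {subset [:: p1; p2; q1; q2] <= [:: p1; p2; q1; q2]} by [].
have sub1 : {subset [:: p2; p1; q2; q1] <= [:: p1; p2; q1; q2]}.
  by move=> p; rewrite !inE => /or4P[] ->; rewrite ?orbT.
have CSN m n : (C m n p1 - S m n p2) ^+ 2 + (C m n p2 + S m n p1) ^+ 2 =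
               (C m n q1 - S m n q2) ^+ 2 + (C m n q2 + S m n q1) ^+ 2.
  have := CS m (- n); rewrite !CN !SN ?opprK//; by rewrite !inE eqxx ?orbT.
(* The real and the imaginary part of [F (x) conj F - H (x) conj H]; the signs
   [n] and [- n] separate their moments. *)
split.
- have := @integral_tensor_rect_eq0 _ 4 (nth 0 [:: 1; 1; -1; -1])
    (nth p1 [:: p1; p2; q1; q2]) (nth p1 [:: p1; p2; q1; q2]) c l c0 l0
    (fun i => (ips _ sub0 i).1) (fun i => (ips _ sub0 i).1)
    (fun i => (ips _ sub0 i).2) (fun i => (ips _ sub0 i).2).
  move=> /(_ _ _ A B mA mB); rewrite !big_ord_recl big_ord0/= => H.
  apply/eqP; rewrite -subr_eq0 -[X in _ == X]H; first by apply/eqP; rewrite /I; ring.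
  + move=> m n; rewrite !big_ord_recl big_ord0/= -!/(C m n _) -!/(S m n _).
    by have := CS m n; have := CSN m n; lra.
  + by move=> m n; rewrite !big_ord_recl big_ord0/= -!/(C m n _) -!/(S m n _); ring.
(* The imaginary part is antisymmetric: its cosine moments cancel identically, and its sine moments
   come from the part of the squared modulus odd in [n]. For the symmetric real part above, the
   roles are exchanged. *)
- have := @integral_tensor_rect_eq0 _ 4 (nth 0 [:: 1; -1; -1; 1])
    (nth p1 [:: p1; p2; q1; q2]) (nth p1 [:: p2; p1; q2; q1]) c l c0 l0
    (fun i => (ips _ sub0 i).1) (fun i => (ips _ sub1 i).1)
    (fun i => (ips _ sub0 i).2) (fun i => (ips _ sub1 i).2).
  move=> /(_ _ _ A B mA mB); rewrite !big_ord_recl big_ord0/= => H.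
  apply/eqP; rewrite -subr_eq0 -[X in _ == X]H; first by apply/eqP; rewrite /I; ring.
  + by move=> m n; rewrite !big_ord_recl big_ord0/= -!/(C m n _) -!/(S m n _); ring.
  + move=> m n; rewrite !big_ord_recl big_ord0/= -!/(C m n _) -!/(S m n _).
    by have := CS m n; have := CSN m n; lra.
Qed.

End Phase.

(** * Gabor samples *)

Section GaborSamples.
Context {R : realType}.
Local Notation mu := (@lebesgue_measure R).
Implicit Types p q : R -> R.

(** On the bounded interval |w| <= 1 + |w|^4, and |w|^4 is at most [N], the fourth power of the
    modulus of [F]; outside it [F] is 0. *)
Lemma Lp4_integrable (c : R) (f : R -> R[i]) : Lp_interval 4 c f ->
  mu.-integrable setT (EFin \o (fun t => complex.Re (zero_ext c f t))) /\
  mu.-integrable setT (EFin \o (fun t => complex.Im (zero_ext c f t))).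
Proof.
rewrite /Lp_interval; set F := zero_ext c f; move=> [[mr mi] nF].
pose N t := (complex.Re (F t) ^+ 2 + complex.Im (F t) ^+ 2) ^+ 2.
have N4 t : ComplexField.Normc.normc (F t) `^ 4 = N t.
  rewrite /N; case: (F t) => a b /=; rewrite powR_mulrn ?sqrtr_ge0//.
  by rewrite (exprM _ 2 2) sqr_sqrtr// addr_ge0 ?sqr_ge0.
have mN : measurable_fun setT N.
  by apply: measurable_funX; apply: measurable_funD; exact: measurable_funX.
have N0 t : 0 <= N t by rewrite sqr_ge0.
have iN : mu.-integrable setT (EFin \o N).
  apply/integrableP; split; first exact/measurable_EFinP.
  have n4 : (4 : R) != 0 by rewrite pnatr_eq0.
  have := poweR_lty 4 nF; rewrite (poweR_Lnorm _ _ n4); congr (_ < _)%E.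
  apply: eq_integral => t _ /=; rewrite -N4 (ger0_norm (powR_ge0 _ _)).
  by rewrite ger0_norm//; case: (F t) => a b /=; exact: sqrtr_ge0.
have i1 : mu.-integrable setT (EFin \o (\1_`[- (c / 2), c / 2]%classic : R -> R)).
  exact: integrable_indic_itv.
have key (w : R -> R) : measurable_fun setT w ->
    (forall t, F t = 0 -> w t = 0) -> (forall t, w t ^+ 4 <= N t) ->
    mu.-integrable setT (EFin \o w).
  move=> mw w0 wN.
  apply: (le_integrable measurableT _ _ (integrableD measurableT i1 iN)).
    exact/measurable_EFinP.
  move=> t _ /=; rewrite lee_fin [leRHS]ger0_norm ?addr_ge0 ?indicE//.
  have [tI|tI] := boolP (t \in `[- (c / 2), c / 2]%classic); last first.
    rewrite w0 ?normr0 ?addr_ge0//; by rewrite /F /zero_ext /patch (negbTE tI).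
  have := wN t; rewrite (exprM _ 2 2) -(real_normK (num_real (w t))) -exprM.
  have := normr_ge0 (w t); set z := `|w t| => z0 zN.
  apply: le_trans (lerD (lexx _) zN).
  have [z1|z1] := leP z 1; first by rewrite ler_wpDr// exprn_ge0.
  by rewrite ler_wpDl// ler_eXnr// ltW.
split; apply: key => // t; rewrite /N; try by move=> ->.
  by rewrite (exprM _ 2 2) lerXn2r// ?nnegrE ?addr_ge0 ?sqr_ge0// lerDl sqr_ge0.
by rewrite (exprM _ 2 2) lerXn2r// ?nnegrE ?addr_ge0 ?sqr_ge0// lerDr sqr_ge0.
Qed.

(** If F(B) is nonzero for some [B], dividing F(A) conj F(B) = H(A) conj H(B) by conj F(B) gives
    F(A) = tau H(A) for all [A], and integrals over all measurable sets determine an integrable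
    function almost everywhere. *)
Lemma exists_phase p1 p2 q1 q2 :
  (forall p, p \in [:: p1; p2; q1; q2] -> mu.-integrable setT (EFin \o p)) ->
  let I A p := \int[mu]_(x in A) p x in
  (forall A B, measurable A -> measurable B ->
    I A p1 * I B p1 + I A p2 * I B p2 = I A q1 * I B q1 + I A q2 * I B q2) ->
  (forall A B, measurable A -> measurable B ->
    I A p1 * I B p2 - I A p2 * I B p1 = I A q1 * I B q2 - I A q2 * I B q1) ->
  exists t1 t2 : R, [/\ t1 ^+ 2 + t2 ^+ 2 = 1,
    {ae mu, forall x, p1 x = t1 * q1 x - t2 * q2 x} &
    {ae mu, forall x, p2 x = t1 * q2 x + t2 * q1 x}].
Proof.
move=> ip I Hre Him.
have ip1 : mu.-integrable setT (EFin \o p1) by apply: ip; rewrite !inE eqxx ?orbT.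
have ip2 : mu.-integrable setT (EFin \o p2) by apply: ip; rewrite !inE eqxx ?orbT.
have iq1 : mu.-integrable setT (EFin \o q1) by apply: ip; rewrite !inE eqxx ?orbT.
have iq2 : mu.-integrable setT (EFin \o q2) by apply: ip; rewrite !inE eqxx ?orbT.
have iZ (t : R) p : mu.-integrable setT (EFin \o p) ->
  mu.-integrable setT (EFin \o (fun x => t * p x)) by move=> ip'; exact: (integrableZl measurableT t ip').
have ae_comb p q q' (t t' : R) : mu.-integrable setT (EFin \o p) ->
    mu.-integrable setT (EFin \o q) -> mu.-integrable setT (EFin \o q') ->
    (forall A, measurable A -> I A p = t * I A q + t' * I A q') ->
    {ae mu, forall x, p x = t * q x + t' * q' x}.
  move=> ip0 iq0 iq0' Ipq.
  have icomb := integrableD measurableT (iZ t q iq0) (iZ t' q' iq0').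
  have := integral_ae_eq measurableT ip0 (measurable_int _ icomb).
  move=> H; have {}H : ae_eq mu setT (EFin \o p) (fun x => (t * q x)%:E + (t' * q' x)%:E)%E.
    apply: H => A _ mA.
    have iS g : mu.-integrable setT (EFin \o g) -> mu.-integrable A (EFin \o g).
      by move=> ig; exact: integrableS ig.
    have E g : mu.-integrable setT (EFin \o g) -> (\int[mu]_(x in A) (g x)%:E)%E = (I A g)%:E.
      by move=> ig; rewrite /I /Rintegral fineK//; apply: integrable_fin_num => //; exact: iS.
    rewrite integralD//; [|exact: iS (iZ _ _ iq0)|exact: iS (iZ _ _ iq0')].
    rewrite !E//; [|exact: iZ..].
    rewrite Ipq// EFinD; congr (_%:E + _%:E)%E; rewrite /I RintegralZl//; exact: iS.
  by apply: filterS H => x /(_ Logic.I) /= [].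
have [[B [mB NB]]|N0] := pselect (exists B, measurable B /\ I B p1 ^+ 2 + I B p2 ^+ 2 != 0).
  set N := I B p1 ^+ 2 + I B p2 ^+ 2 in NB.
  have NE : N = I B q1 ^+ 2 + I B q2 ^+ 2 by rewrite /N !expr2 Hre.
  (* The real and imaginary parts of tau = F(B) conj H(B) / |F(B)|^2; taking A = B gives |F(B)| =
     |H(B)|, hence |tau| = 1. *)
  exists ((I B q1 * I B p1 + I B q2 * I B p2) / N).
  exists ((I B q1 * I B p2 - I B q2 * I B p1) / N); split.
  - rewrite !expr_div_n -mulrDl.
    have -> : (I B q1 * I B p1 + I B q2 * I B p2) ^+ 2 + (I B q1 * I B p2 - I B q2 * I B p1) ^+ 2
      = N ^+ 2 by rewrite [RHS]expr2 {2}NE /N; ring.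
    by rewrite divff// sqrf_eq0.
  - set t1 := _ / N; set t2 := _ / N.
    suff p1E : {ae mu, forall x, p1 x = t1 * q1 x + (- t2) * q2 x}.
      by move: p1E; apply: (@filterS _ _ (ae_filter_ringOfSetsType mu)) => x ->; rewrite mulNr.
    apply: ae_comb => // A mA; apply: (mulIf NB); rewrite /t1 /t2.
    rewrite mulrDl mulNr (mulrAC _ N^-1) divfK// mulNr (mulrAC _ N^-1) divfK// /N.
    transitivity (I B p1 * (I A p1 * I B p1 + I A p2 * I B p2) +
                  I B p2 * (I A p1 * I B p2 - I A p2 * I B p1)); first by ring.
    by rewrite Hre// Him//; ring.
  - apply: ae_comb => // A mA; apply: (mulIf NB).
    rewrite mulrDl (mulrAC _ N^-1) divfK// (mulrAC _ N^-1) divfK// /N.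
    transitivity (I B p2 * (I A p1 * I B p1 + I A p2 * I B p2) -
                  I B p1 * (I A p1 * I B p2 - I A p2 * I B p1)); first by ring.
    by rewrite Hre// Him//; ring.
(* Otherwise F(A) = 0 for every measurable [A]; the case A = B gives H(A) = 0 too, and tau = 1
   works. *)
have p0 A : measurable A -> I A p1 = 0 /\ I A p2 = 0.
  move=> mA; have : I A p1 ^+ 2 + I A p2 ^+ 2 == 0.
    by apply/negPn/negP => NA; apply: N0; exists A.
  by rewrite paddr_eq0 ?sqr_ge0// !sqrf_eq0 => /andP[/eqP-> /eqP->].
have q0 A : measurable A -> I A q1 = 0 /\ I A q2 = 0.
  move=> mA; have : I A q1 ^+ 2 + I A q2 ^+ 2 == 0.
    by have := Hre _ _ mA mA; have [-> ->] := p0 A mA; rewrite !mul0r addr0 !expr2 => <-.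
  by rewrite paddr_eq0 ?sqr_ge0// !sqrf_eq0 => /andP[/eqP-> /eqP->].
exists 1, 0; split; first by rewrite expr1n expr0n addr0.
  have p1E : {ae mu, forall x, p1 x = 1 * q1 x + 0 * q2 x}.
    apply: ae_comb => // A mA.
    by have [-> _] := p0 A mA; have [-> ->] := q0 A mA; rewrite !mulr0 addr0.
  by move: p1E; apply: (@filterS _ _ (ae_filter_ringOfSetsType mu)) => x ->; rewrite !mul0r addr0 subr0.
apply: ae_comb => // A mA.
by have [_ ->] := p0 A mA; have [-> ->] := q0 A mA; rewrite !mulr0 addr0.
Qed.


Lemma ae_patch_open (c : R) p : (forall t, t \notin `[- (c / 2), c / 2] -> p t = 0) ->
  {ae mu, forall t, (p \_ `]- (c / 2), c / 2[%classic) t = p t}.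
Proof.
move=> p0; have n1 (a : R) : mu.-negligible [set a].
  by apply/negligibleP => //; exact: lebesgue_measure_set1.
apply: (negligibleS _ (negligibleU (n1 (- (c / 2))) (n1 (c / 2)))) => t /=.
rewrite patchE mem_setE; case: ifPn => // tI /eqP; rewrite eq_sym => pt.
have : t \in `[- (c / 2), c / 2] by apply/negPn/negP => /p0 pt0; rewrite pt0 eqxx in pt.
move: tI; rewrite !in_itv/= => tI /andP[t1 t2]; move: tI.
rewrite !lt_neqAle t1 t2 !andbT negb_and !negbK => /orP[/eqP->|/eqP->]; [by left|by right].
Qed.

Lemma ae_eq_Rintegral p q : measurable_fun setT p -> measurable_fun setT q ->
  {ae mu, forall t, p t = q t} -> \int[mu]_t p t = \int[mu]_t q t.
Proof.
move=> mp mq pq; rewrite /Rintegral; congr fine.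
apply: ae_eq_integral => //; [exact/measurable_EFinP|exact/measurable_EFinP|].
by move: pq; apply: (@filterS _ _ (ae_filter_ringOfSetsType mu)) => t pq _ /=; rewrite pq.
Qed.

(** * The Gaussian window and the sampled transform *)

Lemma measurable_gauss : measurable_fun setT (@gauss R).
Proof.
apply: measurableT_comp => //; apply: measurableT_comp => //.
by apply: measurable_funM => //; exact: measurable_funX.
Qed.

Lemma gauss_le1 (t : R) : `|gauss t| <= 1.
Proof.
by rewrite ger0_norm ?expR_ge0// -expR0 ler_expR oppr_le0 mulr_ge0 ?pi_ge0 ?sqr_ge0.
Qed.

(** Expanding the square leaves a fixed Gaussian times a power of a single exponential; this is how
    sampling x in steps of 1 / b produces polynomial moments. *)
Lemma gauss_translate (b t : R) (m : nat) :
  gauss (t - b^-1 * m%:R) =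
  expR (- (pi * (b^-1 * m%:R) ^+ 2)) * (gauss t * expR (2 * pi / b * t) ^+ m).
Proof.
rewrite /gauss -expRM_natl -!expRD; congr expR.
by move: (b^-1) (pi : R) => B p; ring.
Qed.

(* The interval is open because the corners (c/2, -c/2) and (-c/2, c/2) of the
   closed square are not separated by the sampled exponentials. *)
Definition windowed (c : R) (w : R -> R) : R -> R :=
  (fun t => w t * gauss t) \_ `]- (c / 2), c / 2[%classic.

Lemma integrable_windowed c w : mu.-integrable setT (EFin \o w) ->
  mu.-integrable setT (EFin \o windowed c w).
Proof.
move=> iw; have iwg : mu.-integrable setT (EFin \o (fun t => w t * gauss t)).
  apply: (integrable_mul_bounded (M := 1)) => // [|t _]; last exact: gauss_le1.
  exact: measurable_gauss.
rewrite /windowed patch_indic; apply: (integrable_mul_bounded (M := 1)) => //.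
by move=> x _; rewrite indicE normr_nat; case: (_ \in _).
Qed.

Lemma windowed_neq0 c w t : windowed c w t != 0 -> `|t| < c / 2.
Proof.
rewrite /windowed patchE mem_setE in_itv/= -ltr_norml.
by case: ifPn => // _; rewrite eqxx.
Qed.

Lemma ae_windowed c w : (forall t, t \notin `[- (c / 2), c / 2] -> w t = 0) ->
  {ae mu, forall t, windowed c w t = w t * gauss t}.
Proof. by move=> w0; apply: ae_patch_open => t /w0 ->; rewrite mul0r. Qed.

Lemma zero_ext_out c (f : R -> R[i]) t :
  t \notin `[- (c / 2), c / 2] -> zero_ext c f t = 0.
Proof. by move=> tI; rewrite /zero_ext /patch mem_setE (negbTE tI). Qed.

(** [gauss_translate] pulls out the factor [E], which is the same for all signals; replacing the
    closed interval by the open one changes the integrand only at two points. *)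
Lemma gabor_sample (b c : R) (f : R -> R[i]) (m : nat) (n : int) :
  0 < b -> 0 < c -> Lp_interval 4 c f ->
  let p1 := windowed c (fun t => complex.Re (zero_ext c f t)) in
  let p2 := windowed c (fun t => complex.Im (zero_ext c f t)) in
  let C p := \int[mu]_x
    (p x * (expR (2 * pi / b * x) ^+ m * cos (n%:~R * (pi / c * x)))) in
  let S p := \int[mu]_x
    (p x * (expR (2 * pi / b * x) ^+ m * sin (n%:~R * (pi / c * x)))) in
  let E := expR (- (pi * (b^-1 * m%:R) ^+ 2)) in
  gabor (zero_ext c f) (b^-1 * m%:R) ((2 * c)^-1 * n%:~R) =
  (E * (C p1 + S p2)) +i* (E * (C p2 - S p1)).
Proof.
move=> b0 c0 fL p1 p2 C S E.
have [i1 i2] := Lp4_integrable fL; set F := zero_ext c f in i1 i2 p1 p2 *.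
have l0 : 0 < 2 * pi / b by rewrite divr_gt0 ?mulr_gt0 ?pi_gt0.
(* The step 1 / (2 c) in frequency makes the angle n pi t / c, which matches the half-period c of
   the difference coordinate. *)
have arg t : 2 * pi * t * ((2 * c)^-1 * n%:~R) = n%:~R * (pi / c * t).
  by move: (pi : R) => p; field; rewrite gt_eqF.
have mc : measurable_fun setT (fun x : R => cos (n%:~R * (pi / c * x))).
  by apply: measurableT_comp measurable_cos _; do 2 apply: measurable_funM => //.
have ms : measurable_fun setT (fun x : R => sin (n%:~R * (pi / c * x))).
  by apply: measurableT_comp measurable_sin _; do 2 apply: measurable_funM => //.
have iC w : mu.-integrable setT (EFin \o w) -> mu.-integrable setT (EFin \o (fun x =>
    windowed c w x * (expR (2 * pi / b * x) ^+ m * cos (n%:~R * (pi / c * x))))).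
  move=> iw; apply: (integrable_mul_expR_bounded m c0 l0 (integrable_windowed c iw) _ mc).
    exact: windowed_neq0.
  by move=> x; exact: norm_cos_le1.
have iS w : mu.-integrable setT (EFin \o w) -> mu.-integrable setT (EFin \o (fun x =>
    windowed c w x * (expR (2 * pi / b * x) ^+ m * sin (n%:~R * (pi / c * x))))).
  move=> iw; apply: (integrable_mul_expR_bounded m c0 l0 (integrable_windowed c iw) _ ms).
    exact: windowed_neq0.
  by move=> x; exact: norm_sin_le1.
have mE : measurable_fun setT (fun t : R => gauss (t - b^-1 * m%:R)).
  by apply: measurableT_comp measurable_gauss _; exact: measurable_funB.
have mw w : mu.-integrable setT (EFin \o w) -> measurable_fun setT w.
  by move=> iw; apply/measurable_EFinP; exact: measurable_int iw.
have ae1 := @ae_windowed c (fun t => complex.Re (F t)) (fun t tI => congr1 _ (zero_ext_out f tI)).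
have ae2 := @ae_windowed c (fun t => complex.Im (F t)) (fun t tI => congr1 _ (zero_ext_out f tI)).
(* One computation for both components: s = 1 gives the real part, s = -1 the imaginary part. *)
have key (u v : R -> R) (s : R) :
    mu.-integrable setT (EFin \o u) -> mu.-integrable setT (EFin \o v) ->
    {ae mu, forall t, windowed c u t = u t * gauss t} ->
    {ae mu, forall t, windowed c v t = v t * gauss t} ->
    \int[mu]_t (gauss (t - b^-1 * m%:R) * (u t * cos (n%:~R * (pi / c * t)) +
                                     s * (v t * sin (n%:~R * (pi / c * t))))) =
    E * (C (windowed c u) + s * S (windowed c v)).
  move=> iu iv aeu aev; have iCu := iC u iu; have iSv := iS v iv.
  have iZ : mu.-integrable setT (EFin \o (fun x => s * (windowed c v x *
      (expR (2 * pi / b * x) ^+ m * sin (n%:~R * (pi / c * x)))))).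
    exact: (integrableZl measurableT s iSv).
  have iD : mu.-integrable setT (EFin \o (fun x =>
      windowed c u x * (expR (2 * pi / b * x) ^+ m * cos (n%:~R * (pi / c * x))) +
      s * (windowed c v x *
        (expR (2 * pi / b * x) ^+ m * sin (n%:~R * (pi / c * x)))))).
    exact: (integrableD measurableT iCu iZ).
  rewrite /S -(RintegralZl s measurableT iSv) /C -(RintegralD measurableT iCu iZ).
  rewrite -(RintegralZl E measurableT iD); apply: ae_eq_Rintegral.
  - apply: measurable_funM => //; apply: measurable_funD.
      by apply: measurable_funM => //; exact: mw.
    by do 2 apply: measurable_funM => //; exact: mw.
  - by apply: measurable_funM => //; exact: mw.
  move: aeu aev; apply: (@filterS2 _ _ (ae_filter_ringOfSetsType mu)) => t -> ->.
  by rewrite gauss_translate -/E; ring.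
rewrite /gabor /complex_integral; congr (_ +i* _).
- rewrite -[S p2]mul1r -key//; apply: eq_Rintegral => t _.
  by rewrite arg /cis cosN sinN; case: (F t) => x y /=; ring.
- rewrite -[- S p1]mulN1r -key//; apply: eq_Rintegral => t _.
  by rewrite arg /cis cosN sinN; case: (F t) => x y /=; ring.
Qed.
End GaborSamples.

(** * From equal samples to a global phase *)

Lemma eq_norm_complex (R : rcfType) (x y : R[i]) : `|x| = `|y| ->
  complex.Re x ^+ 2 + complex.Im x ^+ 2 = complex.Re y ^+ 2 + complex.Im y ^+ 2.
Proof. by move=> xy; apply: complexI; rewrite !add_Re2_Im2 xy. Qed.

Theorem theorem1p4 (R : realType) (b c : R) (f h : R -> R[i])
    (b_gt0 : 0 < b) (c_gt0 : 0 < c)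
    (f_L4 : Lp_interval 4 c f) (h_L4 : Lp_interval 4 c h)
    (eq_samples : forall m n : int,
      `|gabor (zero_ext c f) (b^-1 * m%:~R) ((2 * c)^-1 * n%:~R)| =
      `|gabor (zero_ext c h) (b^-1 * m%:~R) ((2 * c)^-1 * n%:~R)|) :
  exists tau : R[i], `|tau| = 1 /\
    {ae (@lebesgue_measure R),
      forall t, zero_ext c f t = tau * zero_ext c h t}.
Proof.
have [if1 if2] := Lp4_integrable f_L4; have [ih1 ih2] := Lp4_integrable h_L4.
pose p1 := windowed c (fun t => complex.Re (zero_ext c f t)).
pose p2 := windowed c (fun t => complex.Im (zero_ext c f t)).
pose q1 := windowed c (fun t => complex.Re (zero_ext c h t)).
pose q2 := windowed c (fun t => complex.Im (zero_ext c h t)).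
have ip p : p \in [:: p1; p2; q1; q2] ->
    (@lebesgue_measure R).-integrable setT (EFin \o p) /\
    forall x, p x != 0 -> `|x| < c / 2.
  rewrite !inE => /or4P[] /eqP ->; (split; [exact: integrable_windowed|
    by move=> x; exact: windowed_neq0]).
have l0 : 0 < 2 * pi / b by rewrite divr_gt0 ?mulr_gt0 ?pi_gt0.
pose C (m : nat) (n : int) p := \int[@lebesgue_measure R]_x
  (p x * (expR (2 * pi / b * x) ^+ m * cos (n%:~R * (pi / c * x)))).
pose S (m : nat) (n : int) p := \int[@lebesgue_measure R]_x
  (p x * (expR (2 * pi / b * x) ^+ m * sin (n%:~R * (pi / c * x)))).
have samples m n : (C m n p1 + S m n p2) ^+ 2 + (C m n p2 - S m n p1) ^+ 2 =
                   (C m n q1 + S m n q2) ^+ 2 + (C m n q2 - S m n q1) ^+ 2.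
  have := eq_norm_complex (eq_samples m n).
  rewrite -pmulrn !gabor_sample//= !exprMn -!mulrDr.
  (* Both sides carry the same nonzero factor, the square of the exponential in [gabor_sample]. *)
  by apply: mulfI; rewrite expf_neq0// gt_eqF// expR_gt0.
have tens := eq_modulus_tensor c_gt0 l0 ip samples.
have [t1 [t2 [t12 ae1 ae2]]] := exists_phase (fun p pin => (ip p pin).1)
  (fun A B mA mB => (tens A B mA mB).1) (fun A B mA mB => (tens A B mA mB).2).
exists (t1 +i* t2); split.
  by rewrite normc_def/= t12 sqrtr1.
have aeF := ae_windowed (c := c) (fun t tI => congr1 (@complex.Re R) (zero_ext_out f tI)).
have aeF' := ae_windowed (c := c) (fun t tI => congr1 (@complex.Im R) (zero_ext_out f tI)).
have aeH := ae_windowed (c := c) (fun t tI => congr1 (@complex.Re R) (zero_ext_out h tI)).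
have aeH' := ae_windowed (c := c) (fun t tI => congr1 (@complex.Im R) (zero_ext_out h tI)).
have fI := ae_filter_ringOfSetsType (@lebesgue_measure R).
move: (@filterI _ _ fI _ _ (@filterI _ _ fI _ _ aeF aeF') (@filterI _ _ fI _ _ aeH aeH')).
move: (@filterI _ _ fI _ _ ae1 ae2); apply: (@filterS2 _ _ fI) => t /= [].
rewrite /p1 /p2 /q1 /q2 => E1 E2 [[F1 F2] [H1 H2]].
move: E1 E2; rewrite {}F1 {}F2 {}H1 {}H2.
(* The phase relates the windowed signals; dividing by the positive Gaussian transfers it to the
   signals themselves. *)
have g0 : gauss t != 0 by rewrite gt_eqF ?expR_gt0.
case: (zero_ext c f t) => x y; case: (zero_ext c h t) => x' y' /= E1 E2.
congr (_ +i* _); apply: (mulIf g0); first by rewrite E1; ring.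
by rewrite E2; ring.
Qed.
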